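(* Let $\mathcal{X}=(\mathcal{V},\varrho,\upsilon)$ be a fuzzy tree. If $\mathcal{F}$ is the unique maximum spanning tree of $\mathcal{X}$, then $SDI(\mathcal{X})=SDI(\mathcal{F})$.
   Context: A fuzzy graph $\mathcal{X}=(\mathcal{V},\varrho,\upsilon)$ consists of a nonempty finite set $\mathcal{V}$ of vertices, a function $\varrho:\mathcal{V}\to[0,1]$ and a symmetric function $\upsilon:\mathcal{V}\times\mathcal{V}\to[0,1]$ with $\upsilon(ab)\le\min(\varrho(a),\varrho(b))$ for all $a,b$, and no loops ($\upsilon(aa)=0$). Put $\varrho^*=\{a:\varrho(a)>0\}$ and $\upsilon^*=\{ab:\upsilon(ab)>0\}$; it is assumed that $\mathcal{V}=\varrho^*$, and the elements of $\upsilon^*$ are called edges. A path is a sequence of distinct vertices $a_1,\dots,a_m$ with $\upsilon(a_ia_{i+1})>0$ for all $i<m$; its strength is the minimum of the weights $\upsilon$ of its edges. The strength of connectedness $\upsilon^\infty(a,b)$ between $a$ and $b$ is the maximum of the strengths of all paths from $a$ to $b$ (and $0$ if there is none). An edge $ab$ is strong if $\upsilon(ab)$ is at least the strength of connectedness between $a$ and $b$ in the fuzzy graph obtained by deleting the edge $ab$. A spanning fuzzy subgraph of $\mathcal{X}$ is a fuzzy graph $(\mathcal{V},\varrho,\tau)$ with $\tau\le\upsilon$ pointwise; it is a tree if its underlying graph is a tree. $\mathcal{X}$ is a fuzzy tree if it has a spanning fuzzy subgraph $(\mathcal{V},\varrho,\tau)$ that is a tree and satisfies $\upsilon(ab)<\tau^\infty(a,b)$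 for all $ab\in\upsilon^*\setminus\tau^*$, where $\tau^\infty$ is the strength of connectedness in $(\mathcal{V},\varrho,\tau)$. A maximum spanning tree of a connected fuzzy graph $\mathcal{X}$ is a spanning fuzzy subgraph that is a tree such that for all vertices $a,b$ the strength of its unique $a$–$b$ path equals $\upsilon^\infty(a,b)$; a fuzzy tree has a unique maximum spanning tree. A set $\mathcal{D}\subseteq\mathcal{V}$ is a strong dominating set (SDS) if every $b\in\mathcal{V}\setminus\mathcal{D}$ is joined by a strong edge to some $a\in\mathcal{D}$. An SDS $\mathcal{D}$ is a minimal strong dominating set (MSDS) if $\mathcal{D}\setminus\{a\}$ is not an SDS for every $a\in\mathcal{D}$. The weight of $\mathcal{S}\subseteq\mathcal{V}$ is $W(\mathcal{S})=\sum_{a\in\mathcal{S}}\min\{\upsilon(ab): ab \text{ is a strong edge}\}$; whenever weights are used it is understood that every vertex is incident with at least one strong edge. The strong domination degree ${}_{sd}d(u)$ of a vertex $u$ is the minimum of the weights of the MSDSs containing $u$; the strong domination index is $SDI(\mathcal{X})=\sum_{v\in\mathcal{V}}{}_{sd}d(v)$. *)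

(* Defs.v *)
From HB Require Import structures.
From mathcomp Require Import all_boot all_order all_algebra.

Set Implicit Arguments.
Unset Strict Implicit.
Unset Printing Implicit Defensive.

Import Order.TTheory GRing.Theory Num.Theory.
Local Open Scope ring_scope.

(* Weights are only added and compared, so the reals are replaced by an       *)
(* arbitrary ordered field.  An edge ab is the pair of entries ewt a b and    *)
(* ewt b a, which agree by ewt_sym.  Strict positivity in vwt_bound is the    *)
(* assumption that every vertex lies in the support of the vertex weight.     *)
Record fuzzy_graph (R : realFieldType) (V : finType) := FuzzyGraph {
  vwt : V -> R;
  ewt :> V -> V -> R;
  vertex_nonempty : (0 < #|V|)%N;
  vwt_bound : forall a, 0 < vwt a <= 1;
  ewt_bound : forall a b, 0 <= ewt a b <= 1;
  ewt_sym : forall a b, ewt a b = ewt b a;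
  ewt_le_min : forall a b, ewt a b <= Num.min (vwt a) (vwt b);
  ewt_loopless : forall a, ewt a a = 0
}.

Section FuzzyGraphs.

Variables (R : realFieldType) (V : finType).
Implicit Types (G T : fuzzy_graph R V) (a b u : V) (D S : {set V}).

Definition edge G : rel V := fun a b => 0 < G a b.

(* The vertex sequence of the path is a :: p. *)
Definition fuzzy_path G a b (p : seq V) : bool :=
  [&& path (edge G) a p, uniq (a :: p) & last a p == b].

(* pairmap G a p lists the weights of the successive edges of a :: p.  They   *)
(* are at most 1, so the default value 1 only matters for the edgeless path,  *)
(* whose strength is conventionally 1.                                        *)
Definition strength G a (p : seq V) : R :=
  \big[Num.min/1]_(w <- pairmap G a p) w.

(* Vertices of a path are distinct, so p has fewer than #|V| terms.           *)
Definition conn_strength G a b : R :=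
  \big[Num.max/0]_(p : {bseq #|V| of V} | fuzzy_path G a b p) strength G a p.

Section DeleteEdge.

Variables (G : fuzzy_graph R V) (a b : V).

Definition delete_ewt (x y : V) : R :=
  if ((x == a) && (y == b)) || ((x == b) && (y == a)) then 0 else G x y.

Lemma delete_ewt_bound x y : 0 <= delete_ewt x y <= 1.
Proof.
by rewrite /delete_ewt; case: ifP => _; [rewrite lexx ler01 | apply: ewt_bound].
Qed.

Lemma delete_ewt_sym x y : delete_ewt x y = delete_ewt y x.
Proof. by rewrite /delete_ewt ewt_sym orbC ![(y == _) && _]andbC. Qed.

Lemma delete_ewt_le_min x y : delete_ewt x y <= Num.min (vwt G x) (vwt G y).
Proof.
apply: le_trans (ewt_le_min G x y); rewrite /delete_ewt; case: ifP => // _.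
by case/andP: (ewt_bound G x y).
Qed.

Lemma delete_ewt_loopless x : delete_ewt x x = 0.
Proof. by rewrite /delete_ewt ewt_loopless if_same. Qed.

Definition delete_edge : fuzzy_graph R V :=
  FuzzyGraph (vertex_nonempty G) (vwt_bound G) delete_ewt_bound
    delete_ewt_sym delete_ewt_le_min delete_ewt_loopless.

End DeleteEdge.

Definition strong_edge G : rel V := fun a b =>
  edge G a b && (conn_strength (delete_edge G a b) a b <= G a b).

Definition spanning_subgraph T G : Prop :=
  (forall a, vwt T a = vwt G a) /\ (forall a b, T a b <= G a b).

Definition is_tree G : Prop :=
  (forall a b, connect (edge G) a b) /\
  (forall c : seq V, (2 < size c)%N -> ~~ (cycle (edge G) c && uniq c)).

Definition fuzzy_tree G : Prop :=
  exists T, [/\ spanning_subgraph T G, is_tree T &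
    forall a b, edge G a b -> ~~ edge T a b -> G a b < conn_strength T a b].

(* In a tree there is exactly one path p from a to b.  A spanning tree of G   *)
(* forces G to be connected.                                                  *)
Definition max_spanning_tree T G : Prop :=
  [/\ spanning_subgraph T G, is_tree T &
    forall a b p, fuzzy_path T a b p -> strength T a p = conn_strength G a b].

Definition no_strong_isolated G : Prop :=
  forall a, exists b, strong_edge G a b.

Definition sds G D : bool :=
  [forall b in ~: D, exists a in D, strong_edge G a b].

Definition msds G D : bool := sds G D && [forall a in D, ~~ sds G (D :\ a)].

(* Edge weights are at most 1, so the default value 1 does not affect a       *)
(* minimum over a nonempty set of strong edges.                               *)
Definition weight G S : R :=
  \sum_(a in S) \big[Num.min/1]_(b | strong_edge G a b) G a b.

(* Every vertex lies in some MSDS (any maximal independent set of the graph   *)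
(* of strong edges), and no weight exceeds that of the whole vertex set, so   *)
(* the default value does not affect the minimum.                             *)
Definition sdd G u : R :=
  \big[Num.min/weight G [set: V]]_(D : {set V} | msds G D && (u \in D))
     weight G D.

Definition sdi G : R := \sum_(v : V) sdd G v.

End FuzzyGraphs.

(* Main.v *)
Require Import Defs.
From mathcomp Require Import all_boot all_order all_algebra.

(** Every edge of [F] is strong in [X], and on it [F] and [X] have the same
    weight, both being the strength of connectedness.  An edge of [X] outside
    the tree [T] witnessing that [X] is a fuzzy tree is not strong, as some
    [T]-path between its ends is stronger.  So the strong edges of [X] lie
    between the edges of [F] and those of [T]; as [F] is connected and [T] is
    acyclic, the three sets coincide.  All edges of the tree [F] being strong
    in [F], the two graphs have the same weighted strong edges, and these
    determine the index. *)

Set Implicit Arguments.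
Unset Strict Implicit.
Unset Printing Implicit Defensive.

Import Order.TTheory GRing.Theory Num.Theory.
Local Open Scope ring_scope.

Section FuzzyGraphTheory.

Variables (R : realFieldType) (V : finType).
Implicit Types (G H T F X : fuzzy_graph R V) (a b : V) (p : seq V).

Lemma edge_sym G : symmetric (edge G).
Proof. by move=> a b; rewrite /edge ewt_sym. Qed.

Lemma edge_neq G a b : edge G a b -> a != b.
Proof.
by apply: contraTneq => ->; rewrite /edge ewt_loopless ltxx.
Qed.

Lemma nonedge_ewt G a b : ~~ edge G a b -> G a b = 0.
Proof.
rewrite /edge -leNgt => Gab_le0; apply/eqP; rewrite eq_le Gab_le0 /=.
by case/andP: (ewt_bound G a b).
Qed.

Lemma strength_edge G a b : strength G a [:: b] = G a b.
Proof.
rewrite /strength /= big_cons big_nil; apply/min_idPl.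
by case/andP: (ewt_bound G a b).
Qed.

Lemma fuzzy_path_edge G a b : edge G a b -> fuzzy_path G a b [:: b].
Proof.
by move=> Gab; rewrite /fuzzy_path /= Gab inE (edge_neq Gab) eqxx.
Qed.

Lemma strength_le_conn G a b (p : {bseq #|V| of V}) :
  fuzzy_path G a b p -> strength G a p <= conn_strength G a b.
Proof.
exact: (@le_bigmax_cond _ _ _ 0 p (fun q : {bseq #|V| of V} => fuzzy_path G a b q)
  (fun q => strength G a q)).
Qed.

Lemma ewt_le_conn_strength G a b : edge G a b -> G a b <= conn_strength G a b.
Proof.
(* Nonemptiness of [V] is exactly the bound that lets a one-term sequence into the range of the
   maximum. *)
move=> Gab; have szb : (size [:: b] <= #|V|)%N by apply: vertex_nonempty G.
by rewrite -strength_edge (strength_le_conn (p := Bseq szb)) ?fuzzy_path_edge.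
Qed.

Lemma strength_le G H a p :
  (forall x y, G x y <= H x y) -> strength G a p <= strength H a p.
Proof.
move=> leGH; rewrite /strength; elim: p a => [|x p IHp] a /=.
  by rewrite !big_nil.
by rewrite !big_cons le_min !ge_min leGH IHp orbT.
Qed.

Lemma fuzzy_path_sub G H a b p :
  subrel (edge G) (edge H) -> fuzzy_path G a b p -> fuzzy_path H a b p.
Proof.
by move=> sGH /and3P[Gp Up lp]; rewrite /fuzzy_path (sub_path sGH Gp) Up.
Qed.

Lemma conn_strength_ge0 G a b : 0 <= conn_strength G a b.
Proof. exact: bigmax_ge_id. Qed.

Lemma conn_strength_le G H a b :
  (forall x y, G x y <= H x y) -> conn_strength G a b <= conn_strength H a b.
Proof.
move=> leGH; apply/bigmax_leP; split=> [|p Gp]; first exact: conn_strength_ge0.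
apply: le_trans (strength_le a p leGH) (strength_le_conn _).
by apply: fuzzy_path_sub Gp => x y Gxy; apply: lt_le_trans (leGH x y).
Qed.

Lemma delete_edge_le G a b x y : delete_edge G a b x y <= G x y.
Proof.
rewrite /= /delete_ewt; case: ifP => // _.
by case/andP: (ewt_bound G x y).
Qed.

(** A path with two or more edges would close up with the edge [ab] into a cycle on at least three
    vertices. *)
Lemma tree_path_edge G a b p :
  is_tree G -> edge G a b -> fuzzy_path G a b p -> p = [:: b].
Proof.
case=> _ acyclicG Gab /and3P[Gp Up /eqP lp].
case: p Gp Up lp => [|x [|y p]] Gp Up lp.
- by move/edge_neq: Gab; rewrite -lp eqxx.
- by rewrite -lp.
have /negP[] := acyclicG [:: a, x, y & p] isT.
by rewrite Up andbT [cycle _ _](rcons_path _ a (_ :: _)) Gp lp edge_sym.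
Qed.

(** Deleting [ab] removes the only path between its ends, so the strength of connectedness drops to
    the default value 0. *)
Lemma tree_strong_edge G : is_tree G -> strong_edge G =2 edge G.
Proof.
move=> treeG a b; rewrite /strong_edge andb_idr // => Gab.
apply/bigmax_leP; split=> [|p Dp]; first exact: ltW.
have := Dp; rewrite (tree_path_edge treeG Gab (p := p)).
  by rewrite /fuzzy_path /= /edge /= /delete_ewt !eqxx ltxx.
apply: fuzzy_path_sub Dp => x y Dxy.
exact: lt_le_trans Dxy (delete_edge_le G a b x y).
Qed.

Lemma connected_fuzzy_path G a b :
  connect (edge G) a b -> exists p, fuzzy_path G a b p.
Proof.
case/connectP=> p0 Gp0 ->; case/shortenP: Gp0 => p Gp Up _.
by exists p; rewrite /fuzzy_path Gp Up eqxx.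
Qed.

(** The [F]-path joining the ends of a [T]-edge is also a [T]-path, hence that edge itself. *)
Lemma tree_subrel_edge F T :
  is_tree F -> is_tree T -> subrel (edge F) (edge T) ->
  subrel (edge T) (edge F).
Proof.
move=> [connF _] treeT sFT a b Tab.
have [p Fp] := connected_fuzzy_path (connF a b).
have /(tree_path_edge treeT Tab) p_b := fuzzy_path_sub sFT Fp.
by move: Fp; rewrite p_b /fuzzy_path /= => /andP[/andP[]].
Qed.

(** If [ab] is not in [T], then all of [T] survives the deletion of [ab] from [X], and [T] already
    connects [a] and [b] more strongly than [ab] does. *)
Lemma strong_edge_witness X T a b :
  spanning_subgraph T X ->
  (forall x y, edge X x y -> ~~ edge T x y -> X x y < conn_strength T x y) ->
  strong_edge X a b -> edge T a b.
Proof.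
move=> [_ leTX] weakT /andP[Xab strong_ab]; apply: contraTT strong_ab => nTab.
rewrite -ltNge; apply: lt_le_trans (weakT a b Xab nTab) _.
apply: conn_strength_le => x y /=; rewrite /delete_ewt.
(* At the deleted pair, in either order, [T] has weight 0. *)
case: ifP => // /orP[] /andP[/eqP-> /eqP->]; last rewrite ewt_sym.
all: by rewrite nonedge_ewt.
Qed.

Lemma max_spanning_tree_conn F X a b :
  max_spanning_tree F X -> edge F a b -> F a b = conn_strength X a b.
Proof.
by case=> _ _ strF Fab; rewrite -strength_edge; apply/strF/fuzzy_path_edge.
Qed.

(** An edge of [F] is squeezed: [F a b <= X a b <= conn_strength X a b = F a b]. Deletion cannot
    raise the strength of connectedness above this value. *)
Lemma max_spanning_tree_edge F X a b :
  max_spanning_tree F X -> edge F a b -> F a b = X a b /\ strong_edge X a b.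
Proof.
move=> mstF Fab; have [[_ leFX] _ _] := mstF.
have Xab : edge X a b by apply: lt_le_trans (leFX a b).
have F_conn := max_spanning_tree_conn mstF Fab.
split; last first.
  rewrite /strong_edge Xab /= (le_trans _ (leFX a b)) // F_conn.
  exact/conn_strength_le/delete_edge_le.
by apply/eqP; rewrite eq_le leFX F_conn ewt_le_conn_strength.
Qed.

Lemma fuzzy_tree_strong_edge X F :
  fuzzy_tree X -> max_spanning_tree F X -> strong_edge X =2 edge F.
Proof.
move=> [T [spanT treeT weakT]] mstF a b; have [_ treeF _] := mstF.
apply/idP/idP=> [/(strong_edge_witness spanT weakT)|].
  apply: (tree_subrel_edge treeF treeT) => x y.
  by case/(max_spanning_tree_edge mstF) => _ /(strong_edge_witness spanT weakT).
by case/(max_spanning_tree_edge mstF).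
Qed.

Lemma eq_sdi G H :
  strong_edge G =2 strong_edge H ->
  (forall a b, strong_edge G a b -> G a b = H a b) -> sdi G = sdi H.
Proof.
move=> eqS eqW.
have eq_sds D : sds G D = sds H D.
  by apply: eq_forallb => b; congr (_ ==> _); apply: eq_existsb => a; rewrite eqS.
have eq_msds D : msds G D = msds H D.
  by rewrite /msds eq_sds; congr (_ && _); apply: eq_forallb => a; rewrite eq_sds.
have eq_weight D : weight G D = weight H D.
  by apply: eq_bigr => a _; apply: eq_big => [b|b /eqW].
(* The default value of the minimum is a weight too, and is matched first. *)
apply: eq_bigr => v _; rewrite /sdd eq_weight.
by apply: eq_big => [D | D _] //; rewrite eq_msds.
Qed.

End FuzzyGraphTheory.

Theorem theorem4p18 (R : realFieldType) (V : finType) (X F : fuzzy_graph R V)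
  (hX : fuzzy_tree X) (hstrong : no_strong_isolated X)
  (hF : max_spanning_tree F X) :
  sdi X = sdi F.
Proof.
have strongX := fuzzy_tree_strong_edge hX hF.
apply: eq_sdi => a b; last by rewrite strongX => /(max_spanning_tree_edge hF)[].
by case: hF => _ treeF _; rewrite strongX tree_strong_edge.
Qed.
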